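(* Let $n \ge 2$, and let $D(n,d)$ denote the number of monomials in $\partial(\operatorname{stan}_n^{n-2})$ of total degree $d$. Then $D(n,d)$ is equal to the number of uprooted trees on vertex set $[n]$ with exactly $\binom{n}{2} - d + 1$ surface inversions.
   Context: Fix a field $\mathbb{K}$ and let $S = \mathbb{K}[x_1,\dots,x_n]$, $[n]=\{1,\dots,n\}$. For nonempty $\sigma \subseteq [n]$ let $m_\sigma = \prod_{i\in\sigma} x_i^{\,n-|\sigma|+1}$. For $0 \le k \le n-1$ let $M_n^{(k)} = \langle m_\sigma : \sigma \subseteq [n],\ 1 \le |\sigma| \le k+1\rangle \subset S$. The standard monomials of a monomial ideal are the monomials of $S$ not lying in the ideal; $\operatorname{stan}_n^k$ denotes the set of standard monomials of $M_n^{(k)}$. Define $\partial(\operatorname{stan}_n^{n-2}) = \operatorname{stan}_n^{n-2} \setminus \operatorname{stan}_n^{n-1}$. The degree of a monomial is the sum of its exponents. An uprooted tree on $[n]$ is a rooted tree (a labeled tree with a distinguished root vertex) with vertex set $[n]$ such that the root is larger than each of its children (immediate descendants). A surface inversion of an uprooted tree is a pair $(\alpha,\beta)$ of non-root vertices such that $\beta$ is a (not necessarily immediate) descendant of $\alpha$ and $\alpha > \beta$. *)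

(* Defs.v *)
From mathcomp Require Import all_boot all_order all_algebra.
From mathcomp Require Import boolp mpoly.

Set Implicit Arguments.
Unset Strict Implicit.
Unset Printing Implicit Defensive.

Import GRing.Theory.

Local Open Scope ring_scope.

Definition gen_ideal (R : comNzRingType) (I : finType) (P : pred I)
    (g : I -> R) (p : R) : Prop :=
  exists c : I -> R, p = \sum_(i | P i) c i * g i.

Definition m_ (K : fieldType) (n : nat) (s : {set 'I_n}) : {mpoly K[n]} :=
  \prod_(i in s) 'X_i ^+ (n - #|s| + 1)%N.

Definition M_ (K : fieldType) (n k : nat) (p : {mpoly K[n]}) : Prop :=
  gen_ideal [pred s : {set 'I_n} | 1 <= #|s| <= k + 1]%N (@m_ K n) p.

Definition stan (K : fieldType) (n k : nat) (m : 'X_{1..n}) : Prop :=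
  ~ M_ k ('X_[m] : {mpoly K[n]}).

Definition bd_stan (K : fieldType) (n : nat) (m : 'X_{1..n}) : Prop :=
  stan K (n - 2)%N m /\ ~ stan K (n - 1)%N m.

                                                                           
                                                     
Definition D (K : fieldType) (n d : nat) : nat :=
  #|[set m : 'X_{1..n < d.+1} | (mdeg m == d) && `[< bd_stan K m >]]|.

                                                                       
                                                                   
Definition graph (n : nat) := {set {set 'I_n}}.

Definition simple_graph (n : nat) (E : graph n) : Prop :=
  forall e : {set 'I_n}, e \in E -> #|e| = 2%N.

Definition adj (n : nat) (E : graph n) : rel 'I_n :=
  [rel x y | (x != y) && ([set x; y] \in E)].

Definition is_tree (n : nat) (E : graph n) : Prop :=
  [/\ simple_graph E,
      forall x y : 'I_n, connect (adj E) x y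
    & forall s : seq 'I_n, (2 < size s)%N -> ~ ucycle (adj E) s].

                                                                          
                                                    
Definition descendant (n : nat) (E : graph n) (r x y : 'I_n) : Prop :=
  x != y /\
  exists p : seq 'I_n,
    [/\ path (adj E) r p, uniq (r :: p), last r p = y & x \in r :: p].

Definition child (n : nat) (E : graph n) (r x y : 'I_n) : Prop :=
  descendant E r x y /\ adj E x y.

Definition uprooted_tree (n : nat) (t : graph n * 'I_n) : Prop :=
  is_tree t.1 /\ forall c : 'I_n, child t.1 t.2 t.2 c -> (c < t.2)%N.

Definition surface_inversion (n : nat) (t : graph n * 'I_n)
    (ab : 'I_n * 'I_n) : Prop :=
  [/\ ab.1 != t.2, ab.2 != t.2, descendant t.1 t.2 ab.1 ab.2
    & (ab.2 < ab.1)%N].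

Definition surface_inversions (n : nat) (t : graph n * 'I_n) : nat :=
  #|[set ab : 'I_n * 'I_n | `[< surface_inversion t ab >]]|.

(* Main.v *)
Require Import Defs.
From mathcomp Require Import all_boot all_order all_algebra.
From mathcomp Require Import boolp mpoly.
From mathcomp Require Import zify.

Set Implicit Arguments.
Unset Strict Implicit.
Unset Printing Implicit Defensive.

Import GRing.Theory.

(** Up to a shift by one, the exponents of the monomials in the boundary are the
prime parking functions of length [n].  Let [r] be the largest index with
exponent 1.  Deleting [r], and lowering the exponents of the indices above [r]
once more, leaves a parking function [c] of the graph with sink [r] that is
complete except for the edges from [r] to larger vertices.  Uprooted trees with
root [r] are the spanning trees of this graph.

Spanning trees and parking functions are matched by depth-first burning from
[r].  A burnt vertex examines its unburnt neighbours in decreasing order: if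
[c j = 0] then [j] burns, becomes a child of the examining vertex and makes its
own examinations first; otherwise [c j] is decreased.  Each edge is examined
once, except the edges from the parent of [a] to [j] where [j] is a descendant
of [a] and [j < a]: when the turn of such an edge comes, [j] is already burnt.
So the number of refusals, which is the sum of [c], is a constant minus the
number of surface inversions.  The bijection is constructed for an arbitrary
intermediate state of the burning, where both sides satisfy the same
recursion. *)

(** * Trees and parent functions *)

(** Parent function of a tree rooted at [r]; making the root its own parent keeps [f] total. *)
Definition arborescence n (r : 'I_n) (f : {ffun 'I_n -> 'I_n}) : Prop :=
  f r = r /\ forall x, fconnect f x r.

Definition edges n (r : 'I_n) (f : {ffun 'I_n -> 'I_n}) : graph n :=
  [set [set x; f x] | x in predC1 r].

Lemma fconnect_fixed (T : finType) (f : T -> T) x y :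
  f x = x -> fconnect f x y -> y = x.
Proof.
move=> fx /connectP[p]; elim: p => [|z p IH] //= /andP[/eqP <-].
by rewrite fx.
Qed.

Lemma fconnect_step (T : finType) (f : T -> T) x y :
  fconnect f x y -> x = y \/ fconnect f (f x) y.
Proof.
case/connectP=> [[|z p] /=] => [_ ->|/andP[/eqP <- fp] ->]; first by left.
by right; apply/connectP; exists p.
Qed.

Lemma arborescence_neq n (r : 'I_n) f x :
  arborescence r f -> x != r -> f x != x.
Proof.
case=> _ conn xr; apply: contraNneq xr => fx; apply/eqP.
by rewrite (fconnect_fixed fx (conn x)).
Qed.

(** [#|fconnect f x|] serves as the depth of [x]. If [f x] led back to [x], then everything
    reachable from [x] would, including the fixed point [r]. *)
Lemma arborescence_order n (r : 'I_n) f x :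
  arborescence r f -> x != r -> #|fconnect f (f x)| < #|fconnect f x|.
Proof.
move=> af xr; apply: proper_card; apply/properP; split.
  by apply/subsetP=> y; rewrite !inE; apply: connect_trans; apply: fconnect1.
exists x; rewrite !inE ?connect0 //; apply/negP=> fxx.
have closed_x z : fconnect f x z -> fconnect f z x.
  case/connectP=> p; elim/last_ind: p z => [|p y IH] z /=.
    by move=> _ ->; rewrite connect0.
  rewrite rcons_path last_rcons => /andP[fp /eqP <-] ->.
  by have [->|] := fconnect_step (IH _ fp erefl).
case: af => fr conn; move/eqP: xr; case; apply: (fconnect_fixed fr).
exact/closed_x/conn.
Qed.

(** * Edge sets of parent functions *)

Lemma adj_edges n (r : 'I_n) f x y :
  adj (edges r f) x y -> (x != r /\ y = f x) \/ (y != r /\ x = f y).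
Proof.
rewrite /adj /= => /andP[xy /imsetP[z]]; rewrite inE => zr E.
have := set21 x y; have := set22 x y; rewrite E !in_set2.
case/orP=> /eqP yE /orP[] /eqP xE; move: xy; rewrite yE xE ?eqxx //.
  by right.
by left.
Qed.

Lemma adj_sym n (E : graph n) : ssrbool.symmetric (adj E).
Proof. by move=> x y; rewrite /adj /= eq_sym setUC. Qed.

Lemma adj_parent n (r : 'I_n) f x :
  arborescence r f -> x != r -> adj (edges r f) x (f x).
Proof.
move=> af xr; rewrite /adj /= eq_sym (arborescence_neq af xr) /=.
by apply: imset_f; rewrite inE.
Qed.

Lemma edges_connect_root n (r : 'I_n) f x :
  arborescence r f -> connect (adj (edges r f)) x r.
Proof.
move=> af; have [_ /(_ x)/connectP[p]] := af.
elim: p x => [|y p IH] x /=; first by move=> _ ->; exact: connect0.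
case/andP=> /eqP fx fp lp; have [->|xr] := eqVneq x r; first exact: connect0.
by apply: connect_trans (IH y fp lp); rewrite -fx; apply/connect1/adj_parent.
Qed.

Lemma edges_connect n (r : 'I_n) f x y :
  arborescence r f -> connect (adj (edges r f)) x y.
Proof.
move=> af; apply: connect_trans (edges_connect_root x af) _.
by rewrite (sym_connect_sym (@adj_sym _ _)) edges_connect_root.
Qed.

(* A vertex of maximal depth on a cycle would have its parent as both of its
   neighbours there. *)
Lemma edges_acyclic n (r : 'I_n) f (s : seq 'I_n) :
  arborescence r f -> 2 < size s -> ~ ucycle (adj (edges r f)) s.
Proof.
move=> af s3 /andP[cyc us].
have [x0 x0s] : exists x0, x0 \in s.
  by case: s s3 {cyc us} => // x s; exists x; rewrite mem_head.
case: (@arg_maxnP _ x0 (mem s) (fun x => #|fconnect f x|) x0s) => x xs xmax.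
have up y : y \in s -> adj (edges r f) x y -> y = f x.
  move=> ys /adj_edges[[]//|[yr xE]].
  have := xmax y ys; rewrite xE => /leq_trans/(_ (leqnn _)).
  by rewrite leqNgt (arborescence_order af yr).
case/rot_to: xs => i p sE.
have ss y : (y \in s) = (y \in x :: p) by rewrite -sE mem_rot.
have : cycle (adj (edges r f)) (x :: p) by rewrite -sE rot_cycle.
have : uniq (x :: p) by rewrite -sE rot_uniq.
have : 2 < size (x :: p) by rewrite -sE size_rot.
case: p {sE cyc us s3 xmax} ss => [|a p] //; case/lastP: p => [|p b] // ss _.
rewrite /= !rcons_path last_rcons mem_rcons in_cons !negb_or.
case/and3P=> _ /andP[ab _] _ /andP[xa /andP[_ bx]].
have aE : a = f x by apply: up xa; rewrite ss !inE eqxx orbT.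
have bE : b = f x.
  by apply: up; rewrite 1?adj_sym // ss !inE mem_rcons !inE eqxx !orbT.
by rewrite aE bE eqxx in ab.
Qed.

Lemma edges_tree n (r : 'I_n) f : arborescence r f -> is_tree (edges r f).
Proof.
move=> af; split=> [e /imsetP[x]|x y|s s3].
- by rewrite inE => xr ->; rewrite cards2 eq_sym (arborescence_neq af xr).
- exact: edges_connect.
- exact: edges_acyclic.
Qed.

(** After a step down from [u] to [w], the only way up from [w] is back to [u], which uniqueness
    forbids. *)
Lemma edges_path n (r : 'I_n) (f : {ffun 'I_n -> 'I_n}) u p : f r = r ->
  f u \notin p -> uniq (u :: p) -> path (adj (edges r f)) u p ->
  path (fun x y => x == f y) u p.
Proof.
move=> fr; elim: p u => [|w p IH] u //=.
rewrite in_cons negb_or => /andP[fuw fup] /and3P[uwp wp upp] /andP[uw].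
case/adj_edges: uw => [[_ E]|[_ E]]; first by rewrite E eqxx in fuw.
move=> pw; rewrite E eqxx; apply: IH => //=; last by rewrite wp.
by rewrite -E; apply: contra uwp; rewrite inE orbC => ->.
Qed.

Lemma fconnect_parent_path n (f : {ffun 'I_n -> 'I_n}) u p x :
  path (fun x y => x == f y) u p -> x \in u :: p -> fconnect f (last u p) x.
Proof.
elim: p u x => [|w p IH] u x /=; first by rewrite inE => _ /eqP ->.
case/andP=> /eqP E wp; rewrite in_cons => /orP[/eqP ->|]; last exact: IH.
by rewrite E; apply: connect_trans (IH w w wp (mem_head _ _)) (fconnect1 _ _).
Qed.

Lemma parent_path_closed n (f : {ffun 'I_n -> 'I_n}) u p x :
  path (fun x y => x == f y) u p -> x \in p -> f x \in u :: p.
Proof.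
elim: p u => [|w p IH] u //= /andP[/eqP E wp]; rewrite in_cons => /orP[/eqP ->|].
  by rewrite -E mem_head.
by move/(IH _ wp); rewrite (in_cons u) orbC => ->.
Qed.

Lemma parent_path_fconnect n (r : 'I_n) (f : {ffun 'I_n -> 'I_n}) p x y :
  f r = r -> path (fun x y => x == f y) r p -> x \in r :: p ->
  fconnect f x y -> y \in r :: p.
Proof.
move=> fr rp xp /connectP[q]; elim: q x xp => [|z q IH] x xp /=; first by move=> _ ->.
case/andP=> /eqP fx; apply: IH; rewrite -fx.
move: xp; rewrite in_cons => /orP[/eqP ->|]; first by rewrite fr mem_head.
exact: parent_path_closed.
Qed.

(** A simple path from [r] only descends, so its vertices are exactly the [f]-iterates of its
    end. *)
Lemma descendant_edges n (r : 'I_n) f x y : arborescence r f ->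
  descendant (edges r f) r x y <-> x != y /\ fconnect f y x.
Proof.
move=> af; have [fr _] := af; split=> -[xy].
  case=> p [pp up yE xp]; split=> //; rewrite -yE; apply: fconnect_parent_path xp.
  by apply: edges_path pp => //; rewrite fr; case/andP: up.
move=> yx; split=> //.
have /connectP[p pp yE] := edges_connect r y af.
case/shortenP: pp yE => q qq uq _ yE; exists q; split=> //.
apply: (@parent_path_fconnect _ r f q y) => //; last by rewrite yE mem_last.
by apply: edges_path qq => //; rewrite fr; case/andP: uq.
Qed.

Lemma child_root_edges n (r : 'I_n) f x : arborescence r f ->
  child (edges r f) r r x <-> x != r /\ f x = r.
Proof.
move=> af; rewrite /child descendant_edges //; have [fr conn] := af; split.
  by case=> _ /adj_edges[[/eqP//]|[xr xE]].
case=> xr fx; split; first by rewrite eq_sym.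
by rewrite adj_sym -[X in adj _ _ X]fx; apply: adj_parent.
Qed.

(** Induction on depth: if the edge joining [x] to [f x] came from [g (f x) = x], then
    [f (f x) = x], although depth drops at each parent step. *)
Lemma edges_inj n (r : 'I_n) f g : arborescence r f -> arborescence r g ->
  edges r f = edges r g -> f = g.
Proof.
move=> af ag E; apply/ffunP=> x.
have [_ cg] := ag; have [k] := ubnP (#|fconnect f x|).
elim: k x => // k IH x; rewrite ltnS => xk.
have [->|xr] := eqVneq x r; first by case: af ag => -> _ [-> _].
have := adj_parent af xr; rewrite E => /adj_edges[[]//|[fxr xE]].
have := IH (f x) (leq_trans (arborescence_order af xr) xk).
rewrite -xE => ffx.
have := arborescence_order af fxr; rewrite ffx => /ltnW.
by rewrite leqNgt (arborescence_order af xr).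
Qed.

(** The parent of a vertex is a neighbour at smaller distance from [r]. *)
Lemma tree_edges n (E : graph n) r : is_tree E ->
  exists2 f, arborescence r f & E = edges r f.
Proof.
case=> simple conn acyc.
have ex_dist x : exists k, `[< exists p, [/\ path (adj E) x p, last x p = r & size p = k] >].
  by have /connectP[p pp rE] := conn x r; exists (size p); apply/asboolP; exists p.
pose dist x := ex_minn (ex_dist x).
have step x : exists y, x != r -> adj E x y /\ dist y < dist x.
  rewrite {2}/dist; case: ex_minnP => k /asboolP[[|y p] [/= xp lp sp] _].
    by exists x; rewrite lp eqxx.
  exists y => _; case/andP: xp => -> yp; split=> //.
  rewrite /dist; case: ex_minnP => m _ /(_ (size p)); rewrite -sp; apply.
  by apply/asboolP; exists p.
have [g gP] := choice step.
pose f := [ffun x => if x == r then r else g x].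
have fr : f r = r by rewrite ffunE eqxx.
have fP x : x != r -> adj E x (f x) /\ dist (f x) < dist x.
  by move=> xr; rewrite ffunE (negbTE xr); apply: gP.
have af : arborescence r f.
  split=> // x; have [k] := ubnP (dist x).
  elim: k x => // k IH x; rewrite ltnS => xk.
  have [->|xr] := eqVneq x r; first exact: connect0.
  apply: connect_trans (fconnect1 _ _) (IH _ _).
  by apply: leq_trans xk; case: (fP x xr).
exists f => //; apply/eqP; rewrite eqEsubset; apply/andP; split; last first.
  apply/subsetP=> e; case/imsetP=> x; rewrite inE => xr ->.
  by case: (fP x xr) => /andP[].
have subE x y : adj (edges r f) x y -> adj E x y.
  case/adj_edges=> -[/fP[]] //; first by move=> + _ ->.
  by move=> + _ ->; rewrite adj_sym.
(* An edge of [E] outside [edges r f] would close the simple path between its ends, which has at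
   least two steps, into a cycle. *)
apply/subsetP=> e eE; have /eqP/cards2P[x [y [xy eE']]] := simple e eE.
rewrite {}eE' in eE *; apply: contraT => nE.
have /connectP[p pp yE] := edges_connect x y af.
case/shortenP: pp yE => q qq uq _ yE.
case: (acyc (x :: q)); last first.
  rewrite /ucycle uq andbT /= rcons_path -yE (sub_path _ qq) //=.
  by rewrite adj_sym /adj /= xy.
case: q qq yE {uq} => [|a [|b q]] //=; first by move=> _ E'; rewrite E' eqxx in xy.
by rewrite andbT => /andP[_ xa] yE; rewrite yE xa in nE.
Qed.

(** * Depth-first burning *)

Definition upd (T : finType) (X : Type) (f : {ffun T -> X}) j v : {ffun T -> X} :=
  [ffun x => if x == j then v else f x].

Lemma upd_eq (T : finType) X (f : {ffun T -> X}) j v : upd f j v j = v.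
Proof. by rewrite ffunE eqxx. Qed.

Lemma upd_neq (T : finType) X (f : {ffun T -> X}) j v x :
  x != j -> upd f j v x = f x.
Proof. by rewrite ffunE => /negbTE ->. Qed.

Lemma upd_upd (T : finType) X (f : {ffun T -> X}) j v w :
  upd (upd f j v) j w = upd f j w.
Proof. by apply/ffunP=> x; rewrite !ffunE; case: eqP. Qed.

Lemma upd_id (T : finType) X (f : {ffun T -> X}) j v :
  f j = v -> upd f j v = f.
Proof. by move=> fj; apply/ffunP=> x; rewrite ffunE; case: eqP => [->|]. Qed.

Definition occ n (k : 'I_n) (W : seq ('I_n * 'I_n)) :=
  count (fun p => p.2 == k) W.

(* The state of the burning procedure: [U] is the set of unburnt vertices and [W]
   the list of the pending examinations [(v, j)], with [v] burnt and [j] in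
   [U].  Outside [U], [c] and [f] carry the conventional values [0] and [x]. *)
Definition parking n (W : seq ('I_n * 'I_n))
    (U : {set 'I_n}) (c : {ffun 'I_n -> nat}) : Prop :=
  (forall x, x \notin U -> c x = 0) /\
  forall A : {set 'I_n}, A \subset U -> A != set0 ->
    exists2 k, k \in A & c k < occ k W + #|U :\: A|.

Definition forest n (W : seq ('I_n * 'I_n))
    (U : {set 'I_n}) (f : {ffun 'I_n -> 'I_n}) : Prop :=
  [/\ forall x, x \notin U -> f x = x,
      forall x, x \in U -> f x \in U \/ (f x, x) \in W
    & forall x, exists2 y, y \notin U & fconnect f x y].

(* [skipped W U f a k] counts the examinations of [k], an [f]-descendant of [a],
   that the parent of [a] or the pending list would have made after [a] burns,
   and that never take place because [k] burns in the subtree of [a]. *)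
Definition skipped n (W : seq ('I_n * 'I_n))
    (U : {set 'I_n}) (f : {ffun 'I_n -> 'I_n})
    (a k : 'I_n) : nat :=
  if f a \in U then nat_of_bool (k < a) else occ k (drop (index (f a, a) W).+1 W).

Definition total_skipped n (W : seq ('I_n * 'I_n))
    (U : {set 'I_n}) (f : {ffun 'I_n -> 'I_n}) : nat :=
  \sum_(a in U) \sum_(k in U | fconnect f k a) skipped W U f a k.

Definition worklist n (W : seq ('I_n * 'I_n)) (U : {set 'I_n}) : Prop :=
  uniq W /\ forall p, p \in W -> p.1 \notin U /\ p.2 \in U.

Definition fan n (j : 'I_n) (U : {set 'I_n}) : seq ('I_n * 'I_n) :=
  [seq (j, k) | k <- rev (enum U)].

(* The pending list after [j] burns. *)
Definition visit n (j : 'I_n) (U : {set 'I_n}) W : seq ('I_n * 'I_n) :=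
  fan j U ++ [seq p <- W | p.2 != j].

Lemma occ_fan n (j k : 'I_n) U : occ k (fan j U) = (k \in U).
Proof.
rewrite /occ /fan count_map (eq_count (a2 := pred1 k)) //.
by rewrite count_uniq_mem ?rev_uniq ?enum_uniq // mem_rev mem_enum.
Qed.

Lemma occ_filter n (j k : 'I_n) W : k != j ->
  occ k [seq p <- W | p.2 != j] = occ k W.
Proof.
move=> kj; rewrite /occ count_filter; apply: eq_count => p /=.
by case: eqP => //= ->; rewrite kj.
Qed.

Lemma sorted_rev_enum n (U : {set 'I_n}) :
  sorted (fun x y : 'I_n => y < x) (rev (enum U)).
Proof.
rewrite rev_sorted; have -> : enum U = [seq x <- enum 'I_n | x \in U].
  by rewrite enumT.
apply: sorted_filter; first by move=> y x z; apply: ltn_trans.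
by rewrite -(@sorted_map _ _ val ltn) val_enum_ord iota_ltn_sorted.
Qed.

Lemma count_mem_after_desc n (a k : 'I_n) (s : seq 'I_n) :
  sorted (fun x y : 'I_n => y < x) s -> a \in s -> k \in s ->
  count_mem k (drop (index a s).+1 s) = (k < a).
Proof.
have tr : transitive (fun x y : 'I_n => y < x).
  by move=> y x z yx zy; apply: ltn_trans yx.
elim: s => // x s IH /= xs; have /allP below := order_path_min tr xs.
have srt := path_sorted xs.
rewrite !in_cons (eq_sym x); have [-> _|ax /= ain] := eqVneq a x.
  rewrite drop0 => /orP[/eqP ->|kin].
    by rewrite ltnn; apply/count_memPn/negP=> /below; rewrite ltnn.
  rewrite below // count_uniq_mem ?kin //.
  by apply: (sorted_uniq tr _ srt) => y; rewrite ltnn.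
case/orP=> [/eqP ->|kin]; last exact: IH.
rewrite ltnNge ltnW ?below //=; apply/count_memPn/negP=> /mem_drop /below.
by rewrite ltnn.
Qed.

(** The source of inversions: a fan lists vertices in decreasing order, so what remains after [a] is
    smaller than [a]. *)
Lemma occ_drop_fan n (j a k : 'I_n) (U : {set 'I_n}) : a \in U -> k \in U ->
  occ k (drop (index (j, a) (fan j U)).+1 (fan j U)) = (k < a).
Proof.
move=> aU kU; rewrite /occ /fan.
rewrite (index_map (f := pair j)) -?map_drop ?count_map; last by move=> x y [].
rewrite (eq_count (a2 := pred1 k)) // count_mem_after_desc ?mem_rev ?mem_enum //.
exact: sorted_rev_enum.
Qed.

(** * One examination step on parking functions and forests *)

Lemma worklist_visit n (v j : 'I_n) U W : worklist ((v, j) :: W) U ->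
  worklist (visit j (U :\ j) W) (U :\ j).
Proof.
case=> /= /andP[_ uW] VW; have [vU jU] := VW _ (mem_head _ _).
rewrite /= in vU jU; split.
  rewrite cat_uniq filter_uniq // andbT map_inj_uniq ?rev_uniq ?enum_uniq /=; last first.
    by move=> x y [].
  apply/hasPn=> p; rewrite mem_filter => /andP[_ pW].
  apply/negP=> /mapP[k _ E].
  have [] := VW p; first by rewrite inE pW orbT.
  by rewrite E jU.
move=> p; rewrite mem_cat => /orP[/mapP[k]|].
  by rewrite mem_rev mem_enum => kU -> /=; rewrite kU !inE eqxx.
rewrite mem_filter => /andP[pj pW]; have [|p1 p2] := VW p.
  by rewrite inE pW orbT.
by rewrite !inE (negbTE p1) pj p2 andbF.
Qed.

Lemma size_visit n (j : 'I_n) U W :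
  size (visit j U W) + occ j W = #|U| + size W.
Proof.
rewrite size_cat size_map size_rev -cardE size_filter -addnA; congr (_ + _).
by rewrite addnC -(count_predC (fun p => p.2 == j) W).
Qed.

Lemma occ_visit n (j k : 'I_n) (U : {set 'I_n}) W : k \in U -> k != j ->
  occ k (visit j U W) = (occ k W).+1.
Proof.
move=> kU kj; rewrite /visit /occ count_cat -!/(occ _ _) occ_fan kU.
by rewrite occ_filter.
Qed.

(** When [j] burns, each remaining [k] gains a pending examination while the complement of [A] loses
    [j], so the bounds agree. A set containing [j] has [j] itself as witness, thanks to the pending
    [(v, j)]. *)
Lemma parking_accept n (v j : 'I_n) W (U : {set 'I_n}) c : j \in U ->
  parking (visit j (U :\ j) W) (U :\ j) c <->
  parking ((v, j) :: W) U c /\ c j = 0.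
Proof.
move=> jU.
have key (A : {set 'I_n}) k : A \subset U :\ j -> k \in A ->
  occ k (visit j (U :\ j) W) + #|U :\ j :\: A| = occ k ((v, j) :: W) + #|U :\: A|.
  move=> AU kA; have := subsetP AU _ kA; rewrite !inE => /andP[kj kU].
  rewrite occ_visit ?inE ?kj // /occ /= eq_sym (negbTE kj) add0n.
  rewrite (cardsD1 j (U :\: A)) !inE jU andbT.
  have -> : j \notin A by apply/negP=> /(subsetP AU); rewrite !inE eqxx.
  by rewrite setDDl setUC -setDDl addSn addnA addn1 addSn.
split=> [[c0 park]|[[c0 park] cj]]; split.
- split=> [x xU|A AU A0]; first by apply: c0; rewrite !inE negb_and xU orbT.
  have [jA|jA] := boolP (j \in A).
    by exists j => //; rewrite c0 ?inE ?eqxx // /occ /= eqxx.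
  have AU' : A \subset U :\ j by rewrite subsetD1 AU.
  by have [k kA ck] := park A AU' A0; exists k; rewrite -?key.
- by apply: c0; rewrite !inE eqxx.
- move=> x; rewrite !inE negb_and negbK => /orP[/eqP ->//|]; exact: c0.
- move=> A AU A0; have [] := park A _ A0.
    by apply: subset_trans AU _; apply: subD1set.
  by move=> k kA ck; exists k; rewrite ?key.
Qed.

Lemma parking_reject n (v j : 'I_n) W (U : {set 'I_n}) c : j \in U ->
  parking W U c <-> parking ((v, j) :: W) U (upd c j (c j).+1).
Proof.
move=> jU.
have key A k : (upd c j (c j).+1 k < occ k ((v, j) :: W) + #|U :\: A|) =
  (c k < occ k W + #|U :\: A|).
  by rewrite ffunE /occ /= (eq_sym j); case: eqP => [->|].
split=> -[c0 park]; split.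
- move=> x xU; rewrite upd_neq ?c0 //; by apply: contraNneq xU => ->.
- by move=> A AU A0; have [k] := park A AU A0; rewrite -key; exists k.
- by move=> x xU; rewrite -(c0 x xU) upd_neq //; apply: contraNneq xU => ->.
- by move=> A AU A0; have [k] := park A AU A0; rewrite key; exists k.
Qed.

(** Dropping the head only forbids [v] as parent of [j]; by uniqueness [(v, j)] does not recur in
    [W]. *)
Lemma forest_reject n (v j : 'I_n) W U (f : {ffun 'I_n -> 'I_n}) :
  worklist ((v, j) :: W) U ->
  forest W U f <-> forest ((v, j) :: W) U f /\ f j <> v.
Proof.
case=> /= /andP[vW uW] VW; have [vU jU] := VW _ (mem_head _ _).
rewrite /= in vU jU; split=> [[f0 fW fr]|[[f0 fW fr] fj]].
  split; first split=> //.
    by move=> x /fW[]; [left|right; rewrite inE orbC; apply/orP; left].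
  move=> fj; case: (fW _ jU); rewrite fj; first by rewrite (negbTE vU).
  exact/negP.
split=> // x /fW[]; first by left.
by rewrite inE => /orP[/eqP[]|]; [move=> + xj; rewrite xj|right].
Qed.

Lemma fconnect_fixedE (T : finType) (f : T -> T) x y :
  f x = x -> fconnect f x y = (y == x).
Proof.
move=> fx; apply/idP/eqP=> [|->]; [exact: fconnect_fixed|exact: connect0].
Qed.

(** The two orbits of [x] coincide until they meet [j]. *)
Lemma fconnect_agree (T : finType) (f g : T -> T) j x y :
  (forall z, z != j -> f z = g z) -> fconnect f x y ->
  fconnect g x y \/ fconnect g x j /\ fconnect f j y.
Proof.
move=> fg /connectP[p]; elim: p x => [|z p IH] x /=.
  by move=> _ ->; left; apply: connect0.
case/andP=> /eqP fx fp yE; have [<-|xj] := eqVneq x j.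
  right; split; first exact: connect0.
  by apply/connectP; exists (z :: p); rewrite //= fx eqxx.
have xz : fconnect g x z by rewrite -fx fg // fconnect1.
by case: (IH z fp yE) => [|[]] zy; [left|right]; rewrite ?(connect_trans xz zy).
Qed.

(** The burnt [j] takes the conventional value [j], and its children are now attached through its
    fan. *)
Lemma forest_accept n (v j : 'I_n) W U (f : {ffun 'I_n -> 'I_n}) :
  worklist ((v, j) :: W) U ->
  forest ((v, j) :: W) U f -> f j = v ->
  forest (visit j (U :\ j) W) (U :\ j) (upd f j j).
Proof.
move=> [_ VW] [f0 fW fr] fj; have [/= vU jU] := VW _ (mem_head _ _); split.
- move=> x; rewrite !inE negb_and negbK ffunE; case: eqP => // _ /=; exact: f0.
- move=> x; rewrite !inE => /andP[xj xU]; rewrite upd_neq //.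
  have [->|fxj] := eqVneq (f x) j.
    right; rewrite mem_cat map_f ?mem_rev ?mem_enum ?inE ?xj //.
  case: (fW x xU) => [->|]; first by left.
  rewrite inE => /orP[/eqP[_ E]|xW]; first by rewrite E eqxx in xj.
  by right; rewrite mem_cat mem_filter /= xj xW orbT.
- move=> x; have [y yU xy] := fr x.
  case: (@fconnect_agree _ f (upd f j j) j x y) => //.
  + by move=> z zj; rewrite upd_neq.
  + by exists y => //; rewrite !inE (negbTE yU) andbF.
  + by case=> xj _; exists j => //; rewrite !inE eqxx.
Qed.

Lemma forest_unaccept n (v j : 'I_n) W U g : worklist ((v, j) :: W) U ->
  forest (visit j (U :\ j) W) (U :\ j) g -> forest ((v, j) :: W) U (upd g j v).
Proof.
move=> [_ VW] [g0 gW gr]; have [/= vU jU] := VW _ (mem_head _ _); split.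
- move=> x xU; rewrite upd_neq; first by apply: g0; rewrite !inE (negbTE xU) andbF.
  by apply: contraNneq xU => ->.
- move=> x xU; have [->|xj] := eqVneq x j; first by rewrite upd_eq mem_head; right.
  rewrite upd_neq //; case: (gW x); rewrite ?inE ?xj //; first by case/andP; left.
  rewrite mem_cat => /orP[/mapP[k _ [-> _]]|]; first by left.
  by rewrite mem_filter => /andP[_ ->]; right; rewrite orbT.
- move=> x; have [y yU xy] := gr x.
  have jv : fconnect (upd g j v) j v by rewrite -{2}(upd_eq g j v) fconnect1.
  case: (@fconnect_agree _ g (upd g j v) j x y) => //.
  + by move=> z zj; rewrite upd_neq.
  + move=> xy'; have [yj|yj] := eqVneq y j.
      by exists v => //; apply: connect_trans jv; rewrite -[X in fconnect _ _ X]yj.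
    by exists y => //; move: yU; rewrite !inE yj.
  + by case=> xj _; exists v => //; apply: connect_trans jv.
Qed.

(** * Skipped examinations under one step *)

Lemma total_skipped_reject n (v j : 'I_n) W U (f : {ffun 'I_n -> 'I_n}) : f j <> v ->
  total_skipped ((v, j) :: W) U f = total_skipped W U f.
Proof.
move=> fj; apply: eq_bigr => a _; apply: eq_bigr => k _; rewrite /skipped /=.
by case: eqP => [[vE jE]|//]; case: fj; rewrite jE vE.
Qed.

Lemma drop_index_catl (T : eqType) (x : T) s1 s2 : x \in s1 ->
  drop (index x (s1 ++ s2)).+1 (s1 ++ s2) = drop (index x s1).+1 s1 ++ s2.
Proof.
move=> xs; rewrite index_cat xs drop_cat; move: (xs); rewrite -index_mem.
rewrite leq_eqVlt => /orP[/eqP ->|->] //.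
by rewrite ltnn subnn drop0 drop_size.
Qed.

Lemma drop_index_catr (T : eqType) (x : T) s1 s2 : x \notin s1 ->
  drop (index x (s1 ++ s2)).+1 (s1 ++ s2) = drop (index x s2).+1 s2.
Proof.
move=> xs; rewrite index_cat (negbTE xs) drop_cat -addnS ltnNge leq_addr /=.
by rewrite addKn.
Qed.

Lemma occ_drop_filter n (u a j k : 'I_n) W : a != j -> k != j ->
  occ k (drop (index (u, a) [seq p <- W | p.2 != j]).+1 [seq p <- W | p.2 != j]) =
  occ k (drop (index (u, a) W).+1 W).
Proof.
move=> aj kj; elim: W => // p W IH /=.
have [pj|pj] := eqVneq p.2 j => /=.
  have /negbTE -> // : p != (u, a).
  by apply: contraNneq aj => pE; rewrite pE in pj; rewrite -pj.
by case: eqP => // _; rewrite !drop0 occ_filter.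
Qed.

(** Only children [a] of [j] change. Their parent has left the unburnt set, so the count is read off
    the new list: its fan gives [k < a] as before, and the old entries for [k] follow. *)
Lemma skipped_accept n (v j a k : 'I_n) W U (f : {ffun 'I_n -> 'I_n}) :
  worklist ((v, j) :: W) U ->
  forest ((v, j) :: W) U f -> f j = v -> a \in U :\ j -> k \in U :\ j ->
  skipped (visit j (U :\ j) W) (U :\ j) (upd f j j) a k =
  skipped ((v, j) :: W) U f a k + (f a == j) * occ k W.
Proof.
move=> [_ VW] [f0 fW fr] fj aU' kU'; have [/= vU jU] := VW _ (mem_head _ _).
have [aj aU] : a != j /\ a \in U by apply/andP; move: aU'; rewrite !inE.
have [kj kU] : k != j /\ k \in U by apply/andP; move: kU'; rewrite !inE.
rewrite /skipped upd_neq // !inE; have [faj|faj] /= := eqVneq (f a) j.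
  rewrite faj jU mul1n drop_index_catl ?map_f ?mem_rev ?mem_enum //.
  by rewrite /occ count_cat -!/(occ _ _) occ_drop_fan // occ_filter.
rewrite mul0n addn0; case: (boolP (f a \in U)) => // faU.
rewrite drop_index_catr; last by apply/mapP=> -[x _ [E _]]; rewrite E eqxx in faj.
rewrite occ_drop_filter //=; case: eqP => // -[_ E].
by rewrite E eqxx in aj.
Qed.

Lemma fconnect_comparable (T : finType) (f : T -> T) x y z :
  fconnect f x y -> fconnect f x z -> fconnect f y z \/ fconnect f z y.
Proof.
move=> /iter_findex <- /iter_findex <-.
wlog le : y z / findex f x y <= findex f x z.
  move=> H; case: (leqP (findex f x y) (findex f x z)) => [/H //|/ltnW/H].
  by case; [right|left].
by left; rewrite -(subnK le) iterD fconnect_iter.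
Qed.

Lemma fconnect_last_step (T : finType) (f : T -> T) x y :
  x != y -> fconnect f x y -> exists2 z, fconnect f x z & f z = y.
Proof.
move=> xy /connectP[p]; case/lastP: p => [|p z] /=.
  by move=> _ yE; rewrite yE eqxx in xy.
rewrite rcons_path last_rcons => /andP[fp /eqP fz] ->.
by exists (last x p) => //; apply/connectP; exists p.
Qed.

(** On the left, [a = j] contributes [occ k W] for each descendant [k] of [j], itself included. On
    the right, each proper descendant contributes this through the child of [j] above it. *)
Lemma total_skipped_accept n (v j : 'I_n) W U (f : {ffun 'I_n -> 'I_n}) :
  worklist ((v, j) :: W) U ->
  forest ((v, j) :: W) U f -> f j = v ->
  total_skipped ((v, j) :: W) U f =
  total_skipped (visit j (U :\ j) W) (U :\ j) (upd f j j) + occ j W.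
Proof.
move=> VW F fj; have [_ /(_ _ (mem_head _ _))/=[vU jU]] := VW.
have [f0 fW fr] := F.
have from_j a : a \in U :\ j -> fconnect f j a = false.
  rewrite !inE => /andP[aj aU]; apply/negP=> /fconnect_step[E|].
    by rewrite E eqxx in aj.
  by rewrite fj fconnect_fixedE ?f0 // => /eqP E; rewrite E (negbTE vU) in aU.
have fcE a k : a \in U :\ j -> fconnect (upd f j j) k a = fconnect f k a.
  move=> aU; have aj : a != j by move: aU; rewrite !inE => /andP[].
  apply/idP/idP.
    case/(@fconnect_agree _ _ f j) => [z zj||[_]]; rewrite ?upd_neq //.
    by rewrite fconnect_fixedE ?upd_eq // (negbTE aj).
  case/(@fconnect_agree _ _ (upd f j j) j) => [z zj||[_]]; rewrite ?upd_neq //.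
  by rewrite from_j.
rewrite /total_skipped (big_setD1 j) //= addnC.
have -> : \sum_(k in U | fconnect f k j) skipped ((v, j) :: W) U f j k =
    \sum_(k in U :\ j | fconnect f k j) occ k W + occ j W.
  rewrite (bigD1 j) ?jU ?connect0 //= addnC; congr (_ + _); last first.
    by rewrite /skipped fj (negbTE vU) /= eqxx drop0.
  apply: eq_big => [k|k _]; first by rewrite !inE andbC andbA.
  by rewrite /skipped fj (negbTE vU) /= eqxx drop0.
rewrite addnA; congr (_ + _).
transitivity (\sum_(a in U :\ j) \sum_(k in U :\ j | fconnect f k a)
  (skipped ((v, j) :: W) U f a k + (f a == j) * occ k W)); last first.
  apply: eq_bigr => a aU; apply: eq_big => [k|k /andP[kU _]]; first by rewrite fcE.
  by rewrite (skipped_accept VW F fj aU kU).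
under [RHS]eq_bigr => a aU do rewrite big_split /=.
rewrite big_split /=; congr (_ + _).
  apply: eq_bigr => a aU; apply: eq_bigl => k; rewrite !inE.
  by have [->|//] := eqVneq k j; rewrite from_j // andbF.
(* Summing over [k] first, it remains to see that exactly one child of [j] lies on the orbit of a
   proper descendant [k]. *)
rewrite (exchange_big_dep (fun k => k \in U :\ j)) /=; last by move=> a k _ /andP[].
rewrite big_mkcondr /=; apply: eq_bigr => k kU.
have kj : k != j by move: kU; rewrite !inE => /andP[].
have [kj'|kj'] := boolP (fconnect f k j); last first.
  rewrite big1 // => a /andP[aU /andP[_ ka]]; case: eqP => // faj.
  by case/negP: kj'; apply: connect_trans ka _; rewrite -faj fconnect1.
have [a ka faj] := fconnect_last_step kj kj'.
have aU : a \in U :\ j.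
  rewrite !inE; apply/andP; split; first by apply: contraNneq vU => E; rewrite -fj -E faj.
  by apply: contraT => aU; move: jU; rewrite -faj (f0 a aU) (negbTE aU).
rewrite (bigD1 a) ?aU ?kU //= faj eqxx mul1n big1 ?addn0 // => b.
case/andP=> /andP[bU kb] ba; case: eqP => // fbj.
(* Both children are on the orbit of [k], hence comparable; were they distinct, one would be reached
   from [j], against [from_j]. *)
suff E : a = b by rewrite E eqxx in ba.
by case: (fconnect_comparable ka kb) => /fconnect_step[//|];
  rewrite ?faj ?fbj from_j.
Qed.

(** Induction on [#|U|], then on [W]: the head is accepted when [c j = 0], which corresponds to
    [f j = v]. The identity counts examinations: the pending ones and one per pair in [U] are each a
    refusal, an acceptance or a skip. *)
Lemma parking_forest_bij n (U : {set 'I_n}) W : worklist W U ->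
  exists phi psi,
    (forall c, parking W U c -> [/\ forest W U (phi c), psi (phi c) = c
       & \sum_i c i + total_skipped W U (phi c) + #|U| = size W + 'C(#|U|, 2)]) /\
    (forall f, forest W U f -> parking W U (psi f) /\ phi (psi f) = f).
Proof.
have [N] := ubnP #|U|; elim: N U W => // N IHN U W; rewrite ltnS.
elim: W => [|[v j] W IHW] UN VW.
  (* With nothing pending, both sides are empty if [U] is nonempty and have a single element if [U]
     is empty. *)
  exists (fun=> [ffun x => x]), (fun=> [ffun=> 0]).
  have [->|/set0Pn[x xU]] := eqVneq U set0; last first.
    split=> [c [_]|f [_ fU /(_ x)[y yU /connectP[p]]]].
      case/(_ U)=> //; first by apply/set0Pn; exists x.
      by move=> k _; rewrite setDv cards0.
    elim: p x xU => [|z p IH] x xU /=; first by move=> _ yE; rewrite yE xU in yU.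
    by case/andP=> /eqP <-; apply: IH; case: (fU x xU).
  split=> [c [c0 _]|f [f0 _ _]].
    have cE : c = [ffun=> 0] by apply/ffunP=> x; rewrite ffunE c0 ?inE.
    split=> //.
      split=> x; rewrite ?inE ?ffunE //.
      by exists x; rewrite ?inE ?connect0.
    rewrite cE /total_skipped big_set0 cards0 big1 // => i _; exact: ffunE.
  split; last by apply/ffunP=> x; rewrite ffunE f0 ?inE.
  split=> [x _|A]; first exact: ffunE.
  by rewrite subset0 => /eqP ->; rewrite eqxx.
have [_ /(_ _ (mem_head _ _))/=[vU jU]] := VW.
have VW' : worklist W U.
  case: VW => /= /andP[_ uW] VW; split=> // p pW; apply: VW; exact: mem_behead.
have [] := IHN (U :\ j) (visit j (U :\ j) W) _ (worklist_visit VW).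
  by move: UN; rewrite (cardsD1 j) jU.
move=> phi1 [psi1 [bij1 bij1']]; have [phi2 [psi2 [bij2 bij2']]] := IHW UN VW'.
exists (fun c : {ffun 'I_n -> nat} =>
  if c j == 0 then upd (phi1 c) j v else phi2 (upd c j (c j).-1)).
exists (fun f : {ffun 'I_n -> 'I_n} =>
  if f j == v then psi1 (upd f j j) else upd (psi2 f) j (psi2 f j).+1).
split=> [c pc|f ff].
  case: eqP => cj.
    have [|fc cE sumE] := bij1 c; first exact/(parking_accept v).
    have fjj : phi1 c j = j by case: fc => f0 _ _; apply: f0; rewrite !inE eqxx.
    rewrite upd_eq eqxx upd_upd (upd_id fjj); split=> //.
      exact: forest_unaccept.
    rewrite (total_skipped_accept VW) ?upd_eq //; last exact: forest_unaccept.
    (* The fan's [#|U :\ j|] new entries match the drop in the binomial, and the [occ j W] deleted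
       entries match the gain in skips. *)
    rewrite upd_upd (upd_id fjj); have := size_visit j (U :\ j) W.
    move: sumE; rewrite (cardsD1 j U) jU /= add1n binS bin1.
    move: (\sum_i c i) (total_skipped _ _ _) (size (visit _ _ _)) (occ _ _) => S T s o.
    by move: 'C(_, _) => C; move: #|_| (size W) => u w; lia.
  set c' := upd c j (c j).-1.
  have cE : c = upd c' j (c' j).+1.
    by rewrite upd_eq upd_upd prednK ?lt0n; [rewrite upd_id|apply/eqP].
  have [|fc c'E sumE] := bij2 c'.
    by apply/(parking_reject v _ _ jU); rewrite -cE.
  have [fc' /eqP/negbTE fj] := (forest_reject _ VW).1 fc.
  rewrite fj c'E -cE; split=> //.
  rewrite total_skipped_reject; last by apply/eqP; rewrite fj.
  have -> : \sum_i c i = (\sum_i c' i).+1.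
    rewrite (bigD1 j) //= [in RHS](bigD1 j) //= upd_eq -addSn prednK ?lt0n; last exact/eqP.
    by congr (_ + _); apply: eq_bigr => i ij; rewrite upd_neq.
  by rewrite /= !addSn sumE.
case: eqP => fj.
  have [|pc fE] := bij1' (upd f j j); first exact: forest_accept VW ff fj.
  have [pc' cj] := (parking_accept v W _ jU).1 pc.
  by rewrite cj eqxx fE upd_upd (upd_id fj).
have [|pc fE] := bij2' f; first by apply/(forest_reject _ VW).
split; first by apply: (parking_reject v W (psi2 f) jU).1.
by rewrite upd_eq /= upd_upd upd_id.
Qed.

(** * The boundary monomials *)

(** Comparing coefficients at [m], some generator must divide the monomial. *)
Lemma mem_M (K : fieldType) n k (m : 'X_{1..n}) :
  M_ k ('X_[m] : {mpoly K[n]}) <->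
  exists2 s : {set 'I_n}, 1 <= #|s| <= k + 1 &
    forall i, i \in s -> n - #|s| + 1 <= m i.
Proof.
pose e (s : {set 'I_n}) := [multinom if i \in s then n - #|s| + 1 else 0 | i < n].
have mE s : m_ K s = 'X_[e s].
  rewrite mpolyXE_id /m_ big_mkcond; apply: eq_bigr => i _.
  by rewrite mnmE; case: ifP => // _; rewrite expr0.
have eP (s : {set 'I_n}) : reflect (forall i, i \in s -> n - #|s| + 1 <= m i) (e s <= m)%MM.
  apply: (iffP mnm_lepP) => H i; first by move=> si; have := H i; rewrite mnmE si.
  by rewrite mnmE; case: ifP => // /H.
split=> [[c E]|[s sk /eP em]].
  have : (('X_[m] : {mpoly K[n]})@_m != 0)%R by rewrite mcoeffX eqxx oner_neq0.
  rewrite E raddf_sum /=.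
  case: (boolP [exists s : {set 'I_n}, (1 <= #|s| <= k + 1) && (e s <= m)%MM]).
    by case/existsP=> s /andP[sk /eP em] _; exists s.
  rewrite negb_exists => /forallP none; rewrite big1 ?eqxx // => s sk.
  rewrite mE; apply: memN_msupp_eq0; rewrite (perm_mem (msuppMX _ _)).
  apply/mapP=> -[m' _ mE']; have := none s; rewrite sk /= => /negP; apply.
  by rewrite mE' lem_addr.
exists (fun t => if t == s then 'X_[m - e s] else 0%R).
rewrite (bigD1 s) //= eqxx big1 ?addr0 => [|t /andP[_ /negbTE ->]]; last exact: mul0r.
by rewrite mE -mpolyXD submK.
Qed.

(** Positivity says that the product of all variables, the generator of [setT], divides the
    monomial; the second clause says that no generator of a nonempty proper subset does. *)
Definition prime_parking n (m : 'X_{1..n}) : Prop :=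
  (forall i, 0 < m i) /\
  forall s : {set 'I_n}, s != set0 -> s != setT ->
    exists2 i, i \in s & m i + #|s| <= n.

Lemma bd_stanP (K : fieldType) n (m : 'X_{1..n}) : 2 <= n ->
  bd_stan K m <-> prime_parking m.
Proof.
move=> hn; have sT (s : {set 'I_n}) : s != setT -> #|s| < n.
  by rewrite -properT => /proper_card; rewrite cardsT card_ord.
rewrite /bd_stan /stan !mem_M; split=> [[nM /contrapT[s sn sm]]|[m0 mP]].
  have bd (t : {set 'I_n}) : t != set0 -> t != setT -> exists2 i, i \in t & m i + #|t| <= n.
    move=> t0 tT; apply: contrapT => nex; apply: nM; exists t.
      by have := sT t tT; rewrite card_gt0 t0; lia.
    move=> i it; have := sT t tT; case: (leqP (m i + #|t|) n) => [le|]; last by lia.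
    by case: nex; exists i.
  have sE : s = setT.
    apply/eqP; apply: contraT => sT'; have [|i /sm] := bd s _ sT'; last by lia.
    by rewrite -card_gt0; case/andP: sn.
  split=> // i; have := sm i; rewrite sE inE => /(_ isT); lia.
split=> [[s /andP[s0 sn] sm]|].
  have [||i /sm] := mP s; rewrite -?card_gt0 //; last by lia.
  by apply: contraTneq sn => ->; rewrite cardsT card_ord; lia.
rewrite not_notE; exists setT; rewrite cardsT card_ord; first by lia.
by move=> i _; rewrite subnn.
Qed.

(** Exponents above [r] are at least 2, which makes [r] the largest index of exponent 1. *)
Definition encode n (r : 'I_n) (c : {ffun 'I_n -> nat}) : 'X_{1..n} :=
  [multinom if i == r then 1 else c i + 1 + (r < i) | i < n].

(** The initial pending list: the root examines only the vertices that may be its children. *)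
Definition root_fan n (r : 'I_n) : seq ('I_n * 'I_n) := fan r [set k : 'I_n | k < r].

Lemma card_lt_ord n (r : 'I_n) : #|[set k : 'I_n | k < r]| = r.
Proof.
rewrite cardsE -sum1_card (big_ord_narrow (ltnW (ltn_ord r))) /=.
by rewrite sum1_card card_ord.
Qed.

Lemma size_root_fan n (r : 'I_n) : size (root_fan r) = r.
Proof. by rewrite size_map size_rev -cardE card_lt_ord. Qed.

Lemma worklist_root_fan n (r : 'I_n) : worklist (root_fan r) [set~ r].
Proof.
split; first by rewrite map_inj_uniq ?rev_uniq ?enum_uniq // => x y [].
move=> p /mapP[k]; rewrite mem_rev mem_enum inE => kr -> /=.
by rewrite !inE eqxx; split=> //; apply: contraTneq kr => ->; rewrite ltnn.
Qed.

(** For [k] above [r], the missing edge from [r] is balanced by the extra unit in [encode]. *)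
Lemma parking_encodeE n (r k : 'I_n) (s : {set 'I_n}) (c : {ffun 'I_n -> nat}) :
  s \subset [set~ r] -> k \in s ->
  (c k < occ k (root_fan r) + #|[set~ r] :\: s|) = (encode r c k + #|s| <= n).
Proof.
move=> sU ks; have := subsetP sU k ks; rewrite !inE => kr.
have := subset_leq_card sU; have := ltn_ord r.
rewrite occ_fan inE mnmE (negbTE kr) cardsD (setIidPr sU) cardsC1 card_ord.
by move: #|s| (c k) => x y; have : k != r :> nat := kr; case: ltngtP => //= *; lia.
Qed.

Lemma prime_parking_encode n (r : 'I_n) (c : {ffun 'I_n -> nat}) : c r = 0 ->
  parking (root_fan r) [set~ r] c <-> prime_parking (encode r c).
Proof.
move=> cr; split=> [[c0 park]|[_ pr]]; split=> [i|s].
- by rewrite mnmE; case: eqP; lia.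
- move=> s0; rewrite -properT => /proper_card; rewrite cardsT card_ord => sn.
  have [rs|rs] := boolP (r \in s); first by exists r => //; rewrite mnmE eqxx.
  have sU : s \subset [set~ r] by rewrite -setCS setCK sub1set inE.
  have [k ks] := park s sU s0; rewrite parking_encodeE //; by exists k.
- by rewrite !inE negbK => /eqP ->.
- move=> sU s0; have sT : s != setT.
    by apply: contraTneq sU => ->; rewrite subTset; apply/eqP=> /setP/(_ r); rewrite !inE eqxx.
  by have [k ks] := pr s s0 sT; exists k => //; rewrite parking_encodeE.
Qed.

Lemma prime_parking_decode n (m : 'X_{1..n}) : 2 <= n -> prime_parking m ->
  exists r (c : {ffun 'I_n -> nat}), c r = 0 /\ m = encode r c.
Proof.
move=> hn [m0 mP]; have n0 : 0 < n by apply: ltnW.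
(* A set of size [n - 1], nonempty since [n >= 2], forces an exponent equal to 1. *)
have [||i _] := mP [set~ Ordinal n0].
- by rewrite -card_gt0 cardsC1 card_ord; lia.
- by apply/eqP=> /setP/(_ (Ordinal n0)); rewrite !inE eqxx.
rewrite cardsC1 card_ord => mi; have mi1 : m i == 1 by have := m0 i; lia.
case: (@arg_maxnP _ i (fun i => m i == 1) (fun i => i : nat) mi1) => r mr rmax.
exists r, [ffun k => if k == r then 0 else m k - 1 - (r < k)].
split; first by rewrite ffunE eqxx.
apply/mnmP=> k; rewrite mnmE ffunE; case: eqP => [->|_]; first exact/eqP.
have := m0 k; have := rmax k.
case: (ltnP r k) => rk /= H mk; last by rewrite subn0 addn0 subnK.
suff : m k != 1 by lia.
by apply/negP=> /H; rewrite leqNgt rk.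
Qed.

Lemma encode_inj n (r r' : 'I_n) (c c' : {ffun 'I_n -> nat}) : c r = 0 -> c' r' = 0 ->
  encode r c = encode r' c' -> r = r' /\ c = c'.
Proof.
move=> cr cr' /mnmP E.
have rr : r = r'.
  have := E r; have := E r'; rewrite !mnmE !eqxx (eq_sym r').
  have [//|ne] := eqVneq r r'; have : r != r' :> nat := ne.
  by case: (ltngtP r r') => //= *; lia.
split=> //; apply/ffunP=> k; have := E k; rewrite !mnmE -rr.
by case: eqP => [->|_]; [rewrite cr rr cr'|move/addIn/addIn].
Qed.

(** The [r + 1] indices up to [r] are those without the extra unit. *)
Lemma mdeg_encode n (r : 'I_n) (c : {ffun 'I_n -> nat}) : c r = 0 ->
  mdeg (encode r c) + r + 1 = \sum_i c i + n.*2.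
Proof.
move=> cr; rewrite mdegE.
have -> : \sum_i encode r c i = \sum_i (c i + 1 + (r < i)).
  by apply: eq_bigr => i _; rewrite mnmE; case: eqP => // ->; rewrite cr ltnn.
rewrite !big_split /= sum1_card card_ord.
have : \sum_(i < n) (r < i) + \sum_(i < n) (i <= r) = n.
  rewrite -big_split /= -[RHS]card_ord -sum1_card.
  by apply: eq_bigr => i _; case: leqP.
have -> : \sum_(i < n) (i <= r) = r.+1.
  rewrite -big_mkcond /= (big_ord_narrow (ltn_ord r)) /=.
  by rewrite sum1_card card_ord.
by move: (\sum_i c i) (\sum_i _) => S T; lia.
Qed.

(** * From forests to uprooted trees *)

Lemma forest_root_fan n (r : 'I_n) (f : {ffun 'I_n -> 'I_n}) :
  forest (root_fan r) [set~ r] f <->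
  arborescence r f /\ forall k, k != r -> f k = r -> k < r.
Proof.
split=> [[f0 fU fr]|[[fr conn] up]].
  split; first split.
  - by apply: f0; rewrite !inE negbK.
  - by move=> x; have [y] := fr x; rewrite !inE negbK => /eqP ->.
  move=> k kr fk; case: (fU k); rewrite ?fk ?inE ?kr ?eqxx //.
  by case/mapP=> l; rewrite mem_rev mem_enum inE => lr [->].
split=> [x|x|x].
- by rewrite !inE negbK => /eqP ->.
- rewrite !inE => xr; have [fx|fx] := eqVneq (f x) r; last by left.
  by right; rewrite fx map_f ?mem_rev ?mem_enum ?inE ?up.
- by exists r; rewrite // !inE negbK.
Qed.

(** If the parent of [a] is not [r], [skipped] is [k < a] by definition. If it is [r], then [a < r]:
    a vertex [k < r] is settled by the order of the fan, and a [k] above [r] is never pending and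
    exceeds [a]. *)
Lemma total_skipped_root_fan n (r : 'I_n) (f : {ffun 'I_n -> 'I_n}) :
  arborescence r f -> (forall k, k != r -> f k = r -> k < r) ->
  total_skipped (root_fan r) [set~ r] f = surface_inversions (edges r f, r).
Proof.
move=> af up; rewrite /total_skipped /surface_inversions cardsE -sum1_card.
rewrite pair_big_dep [in RHS]big_mkcond [in LHS]big_mkcond /=.
apply: eq_bigr => -[a k] _ /=; rewrite !inE /in_mem /=.
have -> : `[< surface_inversion (edges r f, r) (a, k) >] =
    [&& a != r, k != r, fconnect f k a & k < a].
  apply/asboolP/and4P => [[/= ar kr /(descendant_edges _ _ af)[_ ka] lt]|[ar kr ka lt]].
    by split.
  split=> //; apply/(descendant_edges _ _ af); split=> //=.
  by apply: contraTneq lt => ->; rewrite ltnn.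
have [//|ar] /= := eqVneq a r; have [//|kr] /= := eqVneq k r.
case: ifP => //= ka; suff -> : skipped (root_fan r) [set~ r] f a k = (k < a).
  by case: (k < a).
rewrite /skipped !inE; have [fa|//] := eqVneq (f a) r.
rewrite /= fa; have lt_ar := up a ar fa.
have [lt_kr|le_rk] := ltnP k r; first by rewrite occ_drop_fan ?inE.
rewrite ltnNge (leq_trans (ltnW lt_ar) le_rk) /=; apply/eqP; rewrite -leqn0.
apply: leq_trans (_ : occ k (root_fan r) <= 0).
  set i := (index _ _).+1.
  by rewrite /occ -[X in _ <= count _ X](cat_take_drop i) count_cat leq_addl.
by rewrite occ_fan inE ltnNge le_rk.
Qed.

Lemma uprooted_edges n (r : 'I_n) f : arborescence r f ->
  uprooted_tree (edges r f, r) <-> forest (root_fan r) [set~ r] f.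
Proof.
move=> af; rewrite /uprooted_tree /= forest_root_fan.
split=> -[_ up]; split=> //; last by move=> c /(child_root_edges _ af)[]; apply: up.
  by move=> k kr fk; apply: up; apply/child_root_edges.
exact: edges_tree.
Qed.

Lemma card_uprooted_inversions n d :
  #|[set t : {ffun 'I_n -> 'I_n} * 'I_n |
      `[< forest (root_fan t.2) [set~ t.2] t.1 >] &&
      (total_skipped (root_fan t.2) [set~ t.2] t.1 + d == 'C(n, 2) + 1)]| =
  #|[set t : graph n * 'I_n |
      `[< uprooted_tree t >] && (surface_inversions t + d == 'C(n, 2) + 1)]|.
Proof.
set S := [set t : {ffun 'I_n -> 'I_n} * 'I_n | _].
rewrite -(card_in_imset (f := fun t => (edges t.2 t.1, t.2)) (D := S)).
  apply: eq_card => -[E r]; rewrite [RHS]inE.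
  apply/imsetP/andP=> [[[f r'] + [-> ->]]|[/asboolP ut inv]].
    rewrite inE /= => /andP[/asboolP ff]; have [af up] := (forest_root_fan _ _).1 ff.
    by rewrite total_skipped_root_fan //; split=> //; apply/asboolP/uprooted_edges.
  have [f af EE] := tree_edges r ut.1; rewrite /= in EE.
  exists (f, r); last by rewrite /= EE.
  rewrite {}EE in ut inv.
  have ff := (uprooted_edges af).1 ut; have [_ up] := (forest_root_fan _ _).1 ff.
  by rewrite inE /= total_skipped_root_fan // inv andbT; apply/asboolP.
move=> [f r] [g r']; rewrite !inE /=.
case/andP=> /asboolP/forest_root_fan[af _] _ /andP[/asboolP/forest_root_fan[ag _] _].
by move=> [E rr]; move: ag E; rewrite -rr => ag /(edges_inj af ag) ->.
Qed.

Lemma card_prime_parking n d : 2 <= n ->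
  #|[set t : {ffun 'I_n -> 'I_n} * 'I_n |
      `[< forest (root_fan t.2) [set~ t.2] t.1 >] &&
      (total_skipped (root_fan t.2) [set~ t.2] t.1 + d == 'C(n, 2) + 1)]| =
  #|[set m : 'X_{1..n < d.+1} | (mdeg m == d) && `[< prime_parking m >]]|.
Proof.
move=> hn; set S := [set t : {ffun 'I_n -> 'I_n} * 'I_n | _].
have ex (r : 'I_n) : exists pp, (forall c, parking (root_fan r) [set~ r] c ->
    [/\ forest (root_fan r) [set~ r] (pp.1 c), pp.2 (pp.1 c) = c &
       \sum_i c i + total_skipped (root_fan r) [set~ r] (pp.1 c) + #|[set~ r]| =
       size (root_fan r) + 'C(#|[set~ r]|, 2)]) /\
    (forall f, forest (root_fan r) [set~ r] f ->
       parking (root_fan r) [set~ r] (pp.2 f) /\ pp.1 (pp.2 f) = f).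
  by have [phi [psi H]] := parking_forest_bij (worklist_root_fan r); exists (phi, psi).
have [pp ppP] := choice ex.
pose h (t : {ffun 'I_n -> 'I_n} * 'I_n) := encode t.2 ((pp t.2).2 t.1).
have hP r f : forest (root_fan r) [set~ r] f ->
    [/\ parking (root_fan r) [set~ r] ((pp r).2 f), (pp r).2 f r = 0 &
    mdeg (h (f, r)) + total_skipped (root_fan r) [set~ r] f = 'C(n, 2) + 1].
  move=> ff; have [bij1 /(_ f ff)[pc fE]] := ppP r.
  have cr : (pp r).2 f r = 0 by case: pc => c0 _; apply: c0; rewrite !inE negbK.
  split=> //; have [_ _] := bij1 _ pc; rewrite fE size_root_fan cardsC1 card_ord.
  have := mdeg_encode cr; rewrite /h /=.
  (* The root cancels: the initial list has [r] entries, and the degree formula has [r] with the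
     opposite effect. *)
  have -> : 'C(n, 2) = 'C(n.-1, 2) + n.-1.
    by case: n hn {pp ppP h S ex f ff bij1 pc fE cr r} => // n _; rewrite binS bin1.
  move: (mdeg _) (total_skipped _ _ _) (\sum_i _ i) ('C(_, _)) => *; lia.
(* A default for [insubd], never taken on [S], where [h] has degree exactly [d]. *)
pose b0 : 'X_{1..n < d.+1} := bm0.
have bE m : mdeg m = d -> insubd b0 m = m :> 'X_{1..n}.
  by move=> md; apply: insubdK; rewrite unfold_in md.
rewrite -(card_in_imset (f := fun t => insubd b0 (h t)) (D := S)).
  apply: eq_card => m; rewrite [RHS]inE; apply/imsetP/andP.
    move=> [[f r]]; rewrite inE /= => /andP[/asboolP ff /eqP inv] ->.
    have [pc cr md] := hP _ _ ff; have hd : mdeg (h (f, r)) = d.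
      by apply: (@addIn (total_skipped (root_fan r) [set~ r] f)); rewrite /= md -inv addnC.
    by rewrite bE // hd; split=> //; apply/asboolP/prime_parking_encode.
  case=> /eqP md /asboolP pm; have [r [c [cr mE]]] := prime_parking_decode hn pm.
  have pc : parking (root_fan r) [set~ r] c by apply/prime_parking_encode; rewrite -?mE.
  have [bij1 _] := ppP r; have [ff cE _] := bij1 c pc.
  have hE : h ((pp r).1 c, r) = m by rewrite /h /= cE mE.
  exists ((pp r).1 c, r); last by apply/val_inj; rewrite /= bE hE.
  rewrite inE /=; apply/andP; split; first exact/asboolP.
  by have [_ _] := hP _ _ ff; rewrite hE md addnC => ->.
move=> [f r] [g r']; rewrite !inE /=.
case/andP=> /asboolP ff /eqP fi /andP[/asboolP gg /eqP gi].
have [pf cf df] := hP _ _ ff; have [pg cg dg] := hP _ _ gg.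
have hf : mdeg (h (f, r)) = d.
  by apply: (@addIn (total_skipped (root_fan r) [set~ r] f)); rewrite /= df -fi addnC.
have hg : mdeg (h (g, r')) = d.
  by apply: (@addIn (total_skipped (root_fan r') [set~ r'] g)); rewrite /= dg -gi addnC.
move/(congr1 (fun m : 'X_{1..n < d.+1} => m : 'X_{1..n})); rewrite !bE //.
case/(encode_inj cf cg) => rr E; rewrite /= -rr in gg E *.
have [_ bij2] := ppP r; have [_ <-] := bij2 f ff; have [_ <-] := bij2 g gg.
by rewrite E.
Qed.

Local Open Scope ring_scope.

Theorem theorem3p12 (K : fieldType) (n d : nat) (hn : (2 <= n)%N) :
  D K n d =
  #|[set t : graph n * 'I_n |
      `[< uprooted_tree t >] &&
      ((surface_inversions t)%:Z == 'C(n, 2)%:Z - d%:Z + 1)]|.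
Proof.
transitivity #|[set m : 'X_{1..n < d.+1} | (mdeg m == d) && `[< prime_parking m >]]|.
  apply: eq_card => m; rewrite !inE; congr (_ && _).
  by apply/asboolP/asboolP; rewrite bd_stanP.
rewrite -card_prime_parking // card_uprooted_inversions.
apply: eq_card => t; rewrite !inE; congr (_ && _).
by apply/eqP/eqP; lia.
Qed.
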